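(* Let $\mathcal{O}$ be a Henselian DVR with fraction field $K$, $F/K$ a finite Galois extension, $\mathcal{O}_F$ the integral closure of $\mathcal{O}$ in $F$, and $k_F$ the residue field of $\mathcal{O}_F$. Let $\mathcal{O}_F^{\mathrm{sh}}$ be the strict Henselisation of $\mathcal{O}_F$ and $F^{\mathrm{sh}}$ its fraction field. Let $G$ be a group with a homomorphism $\theta:G\to G_K$, acting through $\theta$ on $\mathrm{Spec}\,\bar K$ by $\sigma\mapsto(\theta(\sigma)^{-1})^*$, and hence on $\mathrm{Spec}\,F$, $\mathrm{Spec}\,\mathcal{O}_F$, $\mathrm{Spec}\,k_F$, $\mathrm{Spec}\,\bar k_F$, $\mathrm{Spec}\,\mathcal{O}_F^{\mathrm{sh}}$, $\mathrm{Spec}\,F^{\mathrm{sh}}$. Let $X/F$ be a scheme on which $G$ acts semilinearly with respect to this action on $\mathrm{Spec}\,F$. Suppose $\mathcal{X}/\mathcal{O}_F$ is a model of $X$ such that for each $\sigma\in G$ the semilinear morphism $\sigma_X$ extends uniquely to a semilinear morphism $\sigma_{\mathcal{X}}:\mathcal{X}\to\mathcal{X}$. Then: (1) The map $\sigma\mapsto\sigma_{\mathcal{X}}$ defines a semilinear action of $G$ on $\mathcal{X}/\mathcal{O}_F$. In particular, it induces by base change a semilinear action of $G$ on the special fibre $\mathcal{X}_{k_F}$, and also induces actions on $\mathcal{X}(\mathcal{O}_F^{\mathrm{sh}})$ and $\mathcal{X}_{k_F}(\bar k_F)$. (2) The natural maps on points $\mathcal{X}(\mathcal{O}_F^{\mathrm{sh}})\to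 X(F^{\mathrm{sh}})$ and $\mathcal{X}(\mathcal{O}_F^{\mathrm{sh}})\to\mathcal{X}_{k_F}(\bar k_F)$ are $G$-equivariant. (3) Suppose $\mathcal{X}(\mathcal{O}_F^{\mathrm{sh}})\to X(F^{\mathrm{sh}})$ is bijective, and let $I$ be the image of $\mathcal{X}(\mathcal{O}_F^{\mathrm{sh}})\to\mathcal{X}_{k_F}(\bar k_F)$. Then the action of $\sigma\in G$ on $I$ is given by $$I\xrightarrow{\ \text{lift}\ }\mathcal{X}(\mathcal{O}_F^{\mathrm{sh}})\xrightarrow{=}X(F^{\mathrm{sh}})\xrightarrow{\ \sigma\ }X(F^{\mathrm{sh}})\xrightarrow{=}\mathcal{X}(\mathcal{O}_F^{\mathrm{sh}})\xrightarrow{\ \text{reduce}\ }I.$$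
   Context: $\bar L$ denotes the separable closure of a field $L$ and $G_L=\mathrm{Gal}(\bar L/L)$. A model $\mathcal{X}/\mathcal{O}_F$ of $X$ is simply a scheme over $\mathcal{O}_F$ with a specified isomorphism $i:\mathcal{X}\times_{\mathcal{O}_F}F\xrightarrow{\cong}X$. For a scheme $S$, $\alpha\in\mathrm{Aut}(S)$ and $S$-schemes $X,Y$, a morphism of schemes $f:X\to Y$ is $\alpha$-linear (semilinear) if $(Y\to S)\circ f=\alpha\circ(X\to S)$. If $G$ acts on $S$, then $G$ acts semilinearly on $X/S$ if $G$ acts (from the left) on the scheme $X$ and each automorphism $\sigma_X$ is $\sigma_S$-linear. In the theorem, $\sigma_{\mathcal{X}}$ is required to be linear over the automorphism of $\mathrm{Spec}\,\mathcal{O}_F$ given by $\sigma$. Action on points: if $G$ acts semilinearly on $X/S$ and $T/S$, then $G$ acts on $X(T)=\mathrm{Hom}_S(T,X)$ by $P\mapsto\sigma_X\circ P\circ\sigma_T^{-1}$; for a ring $R$, $X(R)$ means $X(\mathrm{Spec}\,R)$. Base change action: if $G$ acts semilinearly on $X/S$ and $S'/S$, then $\sigma\in G$ acts on $X_{S'}=X\times_SS'$ by the unique morphism that is compatible with $\sigma_X$ and $\sigma_{S'}$ under the two projections. *)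

(* Defs.v *)
From HB Require Import structures.
From mathcomp Require Import all_boot all_order all_algebra all_field.
From mathcomp Require Import ring.
From mathcomp Require Import boolp classical_sets topology_structure.

Set Implicit Arguments.
Unset Strict Implicit.
Unset Printing Implicit Defensive.

Import GRing.Theory.
Local Open Scope classical_set_scope.
Local Open Scope ring_scope.

Lemma rmorphism_eq (R S : pzSemiRingType) (f g : {rmorphism R -> S}) :
  f =1 g -> f = g.
Proof.
case: f => f [[[f1 f2]] [[f3 f4]]]; case: g => g [[[g1 g2]] [[g3 g4]]] /= fg.
have {}fg : f = g by apply: funext.
case: _ / fg in g1 g2 g3 g4 *.
by rewrite (Prop_irrelevance f1 g1) (Prop_irrelevance f2 g2)
  (Prop_irrelevance f3 g3) (Prop_irrelevance f4 g4).
Qed.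

(* A presheaf is given by a ring [sec U] for every subset [U], but only the
   values at open subsets are constrained and used: this way
   [sec (g @^-1` (f @^-1` U))] is convertible to [sec ((f \o g) @^-1` U)]. *)
Record presheaf (X : topologicalType) := Presheaf {
  sec : set X -> comPzRingType;
  res : forall U V, open U -> open V -> V `<=` U -> {rmorphism sec U -> sec V};
  res_id : forall U (oU oU' : open U) (sUU : U `<=` U) (s : sec U),
    res oU oU' sUU s = s;
  res_comp : forall U V W (oU : open U) (oV oV' : open V) (oW : open W)
    (sVU : V `<=` U) (sWV : W `<=` V) (sWU : W `<=` U) (s : sec U),
    res oV' oW sWV (res oU oV sVU s) = res oU oW sWU s }.
Arguments res {X} p {U V}.

Definition sheaf_separated (X : topologicalType) (O : presheaf X) :=
  forall (I : Type) (U : set X) (V : I -> set X)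
    (oU : open U) (oV : forall i, open (V i)) (sVU : forall i, V i `<=` U),
  U `<=` \bigcup_i V i ->
  forall s t : sec O U,
  (forall i, res O oU (oV i) (sVU i) s = res O oU (oV i) (sVU i) t) -> s = t.

Definition sheaf_gluing (X : topologicalType) (O : presheaf X) :=
  forall (I : Type) (U : set X) (V : I -> set X)
    (oU : open U) (oV : forall i, open (V i)) (sVU : forall i, V i `<=` U),
  U `<=` \bigcup_i V i ->
  forall s : forall i, sec O (V i),
  (forall i j (oVij : open (V i `&` V j)),
     res O (oV i) oVij (@subIsetl _ _ _) (s i) =
     res O (oV j) oVij (@subIsetr _ _ _) (s j)) ->
  exists t : sec O U, forall i, res O oU (oV i) (sVU i) t = s i.

(* The germ at [x] of a section [s] over a neighbourhood [U] of [x] is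
   invertible in the stalk. *)
Definition germ_unit (X : topologicalType) (O : presheaf X) (x : X)
    (U : set X) (oU : open U) (s : sec O U) :=
  exists (V : set X) (oV : open V) (sVU : V `<=` U),
    V x /\ exists t, res O oU oV sVU s * t = 1.

(* The stalks are local rings: they are nonzero (a zero stalk would mean that
   1 = 0 already holds over some neighbourhood), and their non-units are stable
   under addition (two germs have representatives over a common [U]). *)
Definition local_stalks (X : topologicalType) (O : presheaf X) :=
  forall (x : X) (U : set X) (oU : open U), U x ->
    (1 : sec O U) <> 0 /\
    forall s t : sec O U,
      germ_unit x oU (s + t) -> germ_unit x oU s \/ germ_unit x oU t.

Record lrs := LRS {
  space :> topologicalType;
  str : presheaf space;
  str_separated : sheaf_separated str;
  str_gluing : sheaf_gluing str;
  str_local : local_stalks str }.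

Lemma preimage_open (X Y : topologicalType) (f : X -> Y) (U : set Y) :
  continuous f -> open U -> open (f @^-1` U).
Proof. by move=> /continuousP; apply. Qed.

Record lrs_hom (X Y : lrs) := LRSHom {
  base :> X -> Y;
  base_cont : continuous base;
  pull : forall U : set Y, open U ->
    {rmorphism sec (str Y) U -> sec (str X) (base @^-1` U)};
  pull_res : forall (U V : set Y) (oU : open U) (oV : open V) (sVU : V `<=` U)
      (oU' : open (base @^-1` U)) (oV' : open (base @^-1` V))
      (sVU' : base @^-1` V `<=` base @^-1` U) (s : sec (str Y) U),
    pull oV (res (str Y) oU oV sVU s) = res (str X) oU' oV' sVU' (pull oU s);
  (* the induced map on stalks reflects units *)
  pull_local : forall (x : X) (U : set Y) (oU : open U)
      (oU' : open (base @^-1` U)) (s : sec (str Y) U),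
    U (base x) -> germ_unit x oU' (pull oU s) -> germ_unit (base x) oU s }.
Arguments pull {X Y} f {U} : rename.
Arguments pull_local {X Y} f : rename.

Lemma lrs_hom_eq (X Y : lrs) (f g : lrs_hom X Y) :
  f =1 g ->
  (forall (U : set Y) (W : set X) (oU : open U)
     (oF : open (f @^-1` U)) (oG : open (g @^-1` U)) (oW : open W)
     (sF : W `<=` f @^-1` U) (sG : W `<=` g @^-1` U) (s : sec (str Y) U),
     res (str X) oF oW sF (pull f oU s) = res (str X) oG oW sG (pull g oU s)) ->
  f = g.
Proof.
case: f => f fc fp fr fl; case: g => g gc gp gr gl /= fg.
have {}fg : f = g by apply: funext.
case: _ / fg in gc gp gr gl *.
move=> H; suff E : fp = gp.
  case: _ / E in gr gl *.
  by rewrite (Prop_irrelevance fc gc) (Prop_irrelevance fr gr)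
    (Prop_irrelevance fl gl).
apply: functional_extensionality_dep => U.
apply: functional_extensionality_dep => oU.
apply: rmorphism_eq => s.
have oF := preimage_open fc oU.
by have := H U _ oU oF oF oF (@subset_refl _ _) (@subset_refl _ _) s; rewrite !res_id.
Qed.

Section Identity.
Variable X : lrs.

Lemma id_cont : continuous (@id X).
Proof. by move=> x. Qed.

Definition id_pull (U : set X) (oU : open U) :
  {rmorphism sec (str X) U -> sec (str X) (id @^-1` U)} := idfun.

Lemma id_pull_res (U V : set X) (oU : open U) (oV : open V) (sVU : V `<=` U)
  (oU' : open (id @^-1` U)) (oV' : open (id @^-1` V))
  (sVU' : id @^-1` V `<=` id @^-1` U) (s : sec (str X) U) :
  id_pull oV (res (str X) oU oV sVU s) = res (str X) oU' oV' sVU' (id_pull oU s).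
Proof.
rewrite /=.
by rewrite (Prop_irrelevance oU oU') (Prop_irrelevance oV oV')
  (Prop_irrelevance sVU sVU').
Qed.

Lemma id_pull_local (x : X) (U : set X) (oU : open U)
  (oU' : open (id @^-1` U)) (s : sec (str X) U) :
  U x -> germ_unit x oU' (id_pull oU s) -> germ_unit x oU s.
Proof. by rewrite (Prop_irrelevance oU oU'). Qed.

Definition idh : lrs_hom X X := LRSHom id_cont id_pull_res id_pull_local.
End Identity.

Section Composition.
Variables (X Y Z : lrs) (g : lrs_hom Y Z) (f : lrs_hom X Y).

Lemma comp_cont : continuous (g \o f).
Proof. by move=> x; apply: continuous_comp; [exact: base_cont|exact: base_cont]. Qed.

Definition comp_pull (U : set Z) (oU : open U) :
    {rmorphism sec (str Z) U -> sec (str X) ((g \o f) @^-1` U)} :=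
  pull f (preimage_open (@base_cont _ _ g) oU) \o pull g oU.

Lemma comp_pull_res (U V : set Z) (oU : open U) (oV : open V) (sVU : V `<=` U)
  (oU' : open ((g \o f) @^-1` U)) (oV' : open ((g \o f) @^-1` V))
  (sVU' : (g \o f) @^-1` V `<=` (g \o f) @^-1` U) (s : sec (str Z) U) :
  comp_pull oV (res (str Z) oU oV sVU s) =
  res (str X) oU' oV' sVU' (comp_pull oU s).
Proof.
rewrite /= (@pull_res _ _ g U V oU oV sVU (preimage_open (@base_cont _ _ g) oU)
  (preimage_open (@base_cont _ _ g) oV) (fun x => sVU (g x))).
exact: pull_res.
Qed.

Lemma comp_pull_local (x : X) (U : set Z) (oU : open U)
  (oU' : open ((g \o f) @^-1` U)) (s : sec (str Z) U) :
  U ((g \o f) x) -> germ_unit x oU' (comp_pull oU s) ->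
  germ_unit ((g \o f) x) oU s.
Proof.
move=> Ux /= /(pull_local f _ _ _ _ _ Ux) H.
exact: (pull_local g _ _ _ _ _ Ux H).
Qed.

Definition comph : lrs_hom X Z :=
  LRSHom comp_cont comp_pull_res comp_pull_local.
End Composition.

Notation "g '\oh' f" := (comph g f) (at level 50, left associativity).

Section Category.
Implicit Types X Y Z T : lrs.

Lemma comphA X Y Z T (h : lrs_hom Z T) (g : lrs_hom Y Z) (f : lrs_hom X Y) :
  h \oh (g \oh f) = (h \oh g) \oh f.
Proof.
apply: lrs_hom_eq => // U W oU oF oG oW sF sG s /=.
rewrite (Prop_irrelevance oF oG) (Prop_irrelevance sF sG).
by congr (res _ _ _ _ (pull f _ _)); exact: Prop_irrelevance.
Qed.

Lemma comp1h X Y (f : lrs_hom X Y) : idh Y \oh f = f.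
Proof.
apply: lrs_hom_eq => // U W oU oF oG oW sF sG s /=.
rewrite (Prop_irrelevance oF oG) (Prop_irrelevance sF sG).
by congr (res _ _ _ _ (pull f _ _)); exact: Prop_irrelevance.
Qed.

Lemma comph1 X Y (f : lrs_hom X Y) : f \oh idh X = f.
Proof.
apply: lrs_hom_eq => // U W oU oF oG oW sF sG s /=.
by rewrite (Prop_irrelevance oF oG) (Prop_irrelevance sF sG).
Qed.
End Category.

Record prime_ideal (A : comPzRingType) := PrimeIdeal {
  pideal :> A -> Prop;
  pidealD : forall x y, pideal x -> pideal y -> pideal (x + y);
  pidealM : forall x y, pideal y -> pideal (x * y);
  pideal1 : ~ pideal 1;
  pideal_prime : forall x y, pideal (x * y) -> pideal x \/ pideal y;
  pideal0 : pideal 0 }.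

Lemma prime_ideal_eq (A : comPzRingType) (p q : prime_ideal A) :
  (forall x, p x <-> q x) -> p = q.
Proof.
case: p => p p1 p2 p3 p4 p5; case: q => q q1 q2 q3 q4 q5 /= pq.
have {}pq : p = q by apply: funext => x; apply: propext; exact: pq.
case: _ / pq in q1 q2 q3 q4 q5 *.
by rewrite (Prop_irrelevance p1 q1) (Prop_irrelevance p2 q2)
 (Prop_irrelevance p3 q3) (Prop_irrelevance p4 q4) (Prop_irrelevance p5 q5).
Qed.

Section Localisation.
Variables (A : comPzRingType) (p : prime_ideal A).

Lemma pideal_notM x y : ~ p x -> ~ p y -> ~ p (x * y).
Proof. by move=> px py /pideal_prime []. Qed.

Record ratio := Ratio { num : A; den : A; den_notin : ~ p den }.

HB.instance Definition _ := gen_eqMixin ratio.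
HB.instance Definition _ := gen_choiceMixin ratio.

Definition ratio_equiv (x y : ratio) : bool :=
  `[< exists2 u, ~ p u & u * (num x * den y - num y * den x) = 0 >].

Lemma ratio_equiv_refl : reflexive ratio_equiv.
Proof. by move=> x; apply/asboolP; exists 1; [exact: pideal1|rewrite subrr mulr0]. Qed.

Lemma ratio_equiv_sym : symmetric ratio_equiv.
Proof.
suff H x y : ratio_equiv x y -> ratio_equiv y x.
  by move=> x y; apply/idP/idP; exact: H.
by move=> /asboolP[u pu e]; apply/asboolP; exists u => //;
  rewrite -opprB mulrN e oppr0.
Qed.

Lemma ratio_equiv_trans : transitive ratio_equiv.
Proof.
move=> y x z /asboolP[u pu e] /asboolP[v pv e']; apply/asboolP.
exists (u * v * den y).
  by apply: pideal_notM; [exact: pideal_notM|exact: den_notin].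
rewrite (_ : _ * _ = (u * (num x * den y - num y * den x)) * (v * den z) +
  (v * (num y * den z - num z * den y)) * (u * den x)); last by ring.
by rewrite e e' !mul0r addr0.
Qed.

Canonical ratio_equiv_equiv :=
  EquivRel ratio_equiv ratio_equiv_refl ratio_equiv_sym ratio_equiv_trans.

Definition loc : Type := {eq_quot ratio_equiv}%qT.

HB.instance Definition _ := gen_eqMixin loc.
HB.instance Definition _ := gen_choiceMixin loc.

Definition frac (a f : A) (pf : ~ p f) : loc :=
  (\pi_({eq_quot ratio_equiv}) (Ratio a pf))%qT.

Lemma fracP (x : loc) : exists a f (pf : ~ p f), x = frac a pf.
Proof.
exists (num (repr (x : {eq_quot ratio_equiv}%qT))).
exists (den (repr (x : {eq_quot ratio_equiv}%qT))).
exists (@den_notin _); rewrite /frac.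
rewrite -[LHS](@reprK _ {eq_quot ratio_equiv}%qT); congr (\pi_ _)%qT.
by case: (repr _).
Qed.

Lemma frac_eq (a f b g : A) (pf : ~ p f) (pg : ~ p g) :
  frac a pf = frac b pg <-> exists2 u, ~ p u & u * (a * g - b * f) = 0.
Proof.
split=> [/eqmodP/asboolP //|H]; apply/eqmodP/asboolP; exact: H.
Qed.

Lemma frac_eq_mul (a f b g : A) (pf : ~ p f) (pg : ~ p g) :
  a * g = b * f -> frac a pf = frac b pg.
Proof.
move=> e; apply/frac_eq; exists 1; first exact: pideal1.
by rewrite e subrr mulr0.
Qed.

Let rep (x : loc) : ratio := repr (x : {eq_quot ratio_equiv}%qT).

Let repK x : frac (num (rep x)) (@den_notin (rep x)) = x.
Proof.
rewrite /frac -[RHS](@reprK _ {eq_quot ratio_equiv}%qT); congr (\pi_ _)%qT.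
by rewrite /rep; case: (repr _).
Qed.

Definition loc_add (x y : loc) : loc :=
  frac (num (rep x) * den (rep y) + num (rep y) * den (rep x))
    (pideal_notM (@den_notin (rep x)) (@den_notin (rep y))).
Definition loc_mul (x y : loc) : loc :=
  frac (num (rep x) * num (rep y))
    (pideal_notM (@den_notin (rep x)) (@den_notin (rep y))).
Definition loc_opp (x : loc) : loc := frac (- num (rep x)) (@den_notin (rep x)).
Definition loc0 : loc := frac 0 (@pideal1 _ p).
Definition loc1 : loc := frac 1 (@pideal1 _ p).

Lemma loc_addE a f b g (pf : ~ p f) (pg : ~ p g) :
  loc_add (frac a pf) (frac b pg) = frac (a * g + b * f) (pideal_notM pf pg).
Proof.
have /frac_eq[u pu e] := repK (frac a pf).
have /frac_eq[v pv e'] := repK (frac b pg).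
apply/frac_eq; exists (u * v); first exact: pideal_notM.
move: (rep (frac a pf)) (rep (frac b pg)) e e' => [x s ps] [y t pt] /= e e'.
rewrite (_ : _ * _ = (u * (x * f - a * s)) * (v * t * g) +
  (v * (y * g - b * t)) * (u * s * f)); last by ring.
by rewrite e e' !mul0r addr0.
Qed.

Lemma loc_mulE a f b g (pf : ~ p f) (pg : ~ p g) :
  loc_mul (frac a pf) (frac b pg) = frac (a * b) (pideal_notM pf pg).
Proof.
have /frac_eq[u pu e] := repK (frac a pf).
have /frac_eq[v pv e'] := repK (frac b pg).
apply/frac_eq; exists (u * v); first exact: pideal_notM.
move: (rep (frac a pf)) (rep (frac b pg)) e e' => [x s ps] [y t pt] /= e e'.
rewrite (_ : _ * _ = (u * (x * f - a * s)) * (v * y * g) +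
  (v * (y * g - b * t)) * (u * s * a)); last by ring.
by rewrite e e' !mul0r addr0.
Qed.

Lemma loc_oppE a f (pf : ~ p f) : loc_opp (frac a pf) = frac (- a) pf.
Proof.
have /frac_eq[u pu e] := repK (frac a pf).
apply/frac_eq; exists u => //.
move: (rep _) e => [x s ps] /= e.
by rewrite -[RHS]oppr0 -e; ring.
Qed.

Let destr := (loc_addE, loc_mulE, loc_oppE).

Fact loc_addA : associative loc_add.
Proof.
move=> x y z; have [a [f [pf ->]]] := fracP x; have [b [g [pg ->]]] := fracP y.
by have [c [h [ph ->]]] := fracP z; rewrite !destr; apply: frac_eq_mul; ring.
Qed.
Fact loc_addC : commutative loc_add.
Proof.
move=> x y; have [a [f [pf ->]]] := fracP x; have [b [g [pg ->]]] := fracP y.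
by rewrite !destr; apply: frac_eq_mul; ring.
Qed.
Fact loc_add0 : left_id loc0 loc_add.
Proof.
by move=> x; have [a [f [pf ->]]] := fracP x; rewrite !destr; apply: frac_eq_mul; ring.
Qed.
Fact loc_addN : left_inverse loc0 loc_opp loc_add.
Proof.
by move=> x; have [a [f [pf ->]]] := fracP x; rewrite !destr; apply: frac_eq_mul; ring.
Qed.
HB.instance Definition _ := GRing.isZmodule.Build loc
  loc_addA loc_addC loc_add0 loc_addN.

Fact loc_mulA : associative loc_mul.
Proof.
move=> x y z; have [a [f [pf ->]]] := fracP x; have [b [g [pg ->]]] := fracP y.
by have [c [h [ph ->]]] := fracP z; rewrite !destr; apply: frac_eq_mul; ring.
Qed.
Fact loc_mulC : commutative loc_mul.
Proof.
move=> x y; have [a [f [pf ->]]] := fracP x; have [b [g [pg ->]]] := fracP y.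
by rewrite !destr; apply: frac_eq_mul; ring.
Qed.
Fact loc_mul1 : left_id loc1 loc_mul.
Proof.
by move=> x; have [a [f [pf ->]]] := fracP x; rewrite !destr; apply: frac_eq_mul; ring.
Qed.
Fact loc_mulD : left_distributive loc_mul loc_add.
Proof.
move=> x y z; have [a [f [pf ->]]] := fracP x; have [b [g [pg ->]]] := fracP y.
by have [c [h [ph ->]]] := fracP z; rewrite !destr; apply: frac_eq_mul; ring.
Qed.
HB.instance Definition _ := GRing.Zmodule_isComPzRing.Build loc
  loc_mulA loc_mulC loc_mul1 loc_mulD.

Lemma fracD a f b g (pf : ~ p f) (pg : ~ p g) (pfg : ~ p (f * g)) :
  frac a pf + frac b pg = frac (a * g + b * f) pfg.
Proof. by rewrite [LHS]loc_addE; exact: frac_eq_mul. Qed.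
Lemma fracM a f b g (pf : ~ p f) (pg : ~ p g) (pfg : ~ p (f * g)) :
  frac a pf * frac b pg = frac (a * b) pfg.
Proof. by rewrite [LHS]loc_mulE; exact: frac_eq_mul. Qed.
Lemma fracN a f (pf : ~ p f) : - frac a pf = frac (- a) pf.
Proof. exact: loc_oppE. Qed.
Lemma frac1 (p1 : ~ p 1) : 1 = frac 1 p1.
Proof. exact: frac_eq_mul. Qed.
Lemma frac0 (p1 : ~ p 1) : 0 = frac 0 p1.
Proof. exact: frac_eq_mul. Qed.
End Localisation.
Arguments frac {A} p a {f}.

Definition spectrum (A : comPzRingType) : Type := prime_ideal A.

Section Zariski.
Variable A : comPzRingType.

HB.instance Definition _ := gen_eqMixin (spectrum A).
HB.instance Definition _ := gen_choiceMixin (spectrum A).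

Definition vanishing (E : set A) : set (spectrum A) := [set p | E `<=` pideal p].

Definition zariski_open : set_system (spectrum A) :=
  [set U | exists E, U = ~` vanishing E].

Lemma zariski_openP (U : set (spectrum A)) :
  zariski_open U <-> forall p : spectrum A, U p ->
    exists2 f, ~ pideal p f & [set q : spectrum A | ~ pideal q f] `<=` U.
Proof.
split=> [[E ->] p|H].
  move=> /existsNP[f /not_implyP[Ef pf]]; exists f => // q qf Eq.
  exact: qf (Eq _ Ef).
exists [set f | [set q : spectrum A | ~ pideal q f] `<=` U].
apply/seteqP; split=> [p Up Ep|p /existsNP[f /not_implyP[Ef pf]]].
  by have [f pf sf] := H p Up; exact: pf (Ep _ sf).
exact: Ef.
Qed.

Fact zariskiT : zariski_open setT.
Proof. by apply/zariski_openP => p _; exists 1 => //; exact: pideal1. Qed.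
Fact zariskiI : setI_closed zariski_open.
Proof.
move=> U V /zariski_openP oU /zariski_openP oV; apply/zariski_openP => p [Up Vp].
have [f pf sf] := oU p Up; have [g pg sg] := oV p Vp.
exists (f * g); first exact: pideal_notM.
move=> q qfg; split; [apply: sf|apply: sg] => h; apply: qfg => /=.
  by rewrite mulrC; exact: pidealM.
exact: pidealM.
Qed.
Fact zariski_bigcup (I : Type) (U : I -> set (spectrum A)) :
  (forall i, zariski_open (U i)) -> zariski_open (\bigcup_i U i).
Proof.
move=> oU; apply/zariski_openP => p [i _ Uip].
have [f pf sf] := (zariski_openP _).1 (oU i) p Uip.
by exists f => // q /sf ?; exists i.
Qed.

HB.instance Definition _ := isOpenTopological.Build (spectrum A)
  zariskiT zariskiI zariski_bigcup.

Lemma spectrum_open (U : set (spectrum A)) : open U = zariski_open U.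
Proof. by []. Qed.
End Zariski.

(* Sections of the structure sheaf over [U]: functions sending [p] in [U] to an
   element of the localisation at [p], locally given by fractions. *)

Section StructureSheaf.
Variable A : comPzRingType.
Local Notation X := (spectrum A).

Definition locally_fraction (U : set X) (s : forall p : X, U p -> loc p) :=
  forall p : X, U p -> exists V : set X, [/\ open V, V p &
    exists a f : A, forall (q : X) (Uq : U q), V q ->
      exists qf : ~ pideal q f, s q Uq = frac q a qf].

Record spec_sec (U : set X) := SpecSec {
  sfun :> forall p : X, U p -> loc p;
  sfunP : locally_fraction sfun }.

Lemma spec_sec_eq (U : set X) (s t : spec_sec U) :
  (forall p (Up : U p), s p Up = t p Up) -> s = t.
Proof.
case: s t => s sP [t tP] /= st.
have {}st : s = t.
  by do 2!(apply: functional_extensionality_dep => ?); exact: st.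
by case: _ / st in tP *; rewrite (Prop_irrelevance sP tP).
Qed.

HB.instance Definition _ U := gen_eqMixin (spec_sec U).
HB.instance Definition _ U := gen_choiceMixin (spec_sec U).

Section Ring.
Variable U : set X.
Implicit Types s t : spec_sec U.

Fact spec_const_frac (a : A) :
  locally_fraction (fun (p : X) (Up : U p) => frac p a (@pideal1 _ p)).
Proof.
move=> p Up; exists setT; split=> //; first exact: openT.
by exists a, 1 => q Uq _; exists (@pideal1 _ q).
Qed.
Fact spec_add_frac s t : locally_fraction (fun p Up => s p Up + t p Up).
Proof.
move=> p Up; have [V [oV Vp [a [f H]]]] := sfunP s Up.
have [W [oW Wp [b [g K]]]] := sfunP t Up.
exists (V `&` W); split=> //; first exact: openI.
exists (a * g + b * f), (f * g) => q Uq [Vq Wq].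
have [qf ->] := H q Uq Vq; have [qg ->] := K q Uq Wq.
by exists (pideal_notM qf qg); exact: fracD.
Qed.
Fact spec_mul_frac s t : locally_fraction (fun p Up => s p Up * t p Up).
Proof.
move=> p Up; have [V [oV Vp [a [f H]]]] := sfunP s Up.
have [W [oW Wp [b [g K]]]] := sfunP t Up.
exists (V `&` W); split=> //; first exact: openI.
exists (a * b), (f * g) => q Uq [Vq Wq].
have [qf ->] := H q Uq Vq; have [qg ->] := K q Uq Wq.
by exists (pideal_notM qf qg); exact: fracM.
Qed.
Fact spec_opp_frac s : locally_fraction (fun p Up => - s p Up).
Proof.
move=> p Up; have [V [oV Vp [a [f H]]]] := sfunP s Up.
exists V; split=> //; exists (- a), f => q Uq Vq.
by have [qf ->] := H q Uq Vq; exists qf; exact: fracN.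
Qed.

Definition spec_add s t := SpecSec (spec_add_frac s t).
Definition spec_mul s t := SpecSec (spec_mul_frac s t).
Definition spec_opp s := SpecSec (spec_opp_frac s).
Definition spec0 := SpecSec (spec_const_frac 0).
Definition spec1 := SpecSec (spec_const_frac 1).

Fact spec_addA : associative spec_add.
Proof. by move=> r s t; apply: spec_sec_eq => p Up; exact: addrA. Qed.
Fact spec_addC : commutative spec_add.
Proof. by move=> s t; apply: spec_sec_eq => p Up; exact: addrC. Qed.
Fact spec_add0 : left_id spec0 spec_add.
Proof. by move=> s; apply: spec_sec_eq => p Up; exact: add0r. Qed.
Fact spec_addN : left_inverse spec0 spec_opp spec_add.
Proof. by move=> s; apply: spec_sec_eq => p Up; exact: addNr. Qed.
HB.instance Definition _ := GRing.isZmodule.Build (spec_sec U)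
  spec_addA spec_addC spec_add0 spec_addN.

Fact spec_mulA : associative spec_mul.
Proof. by move=> r s t; apply: spec_sec_eq => p Up; exact: mulrA. Qed.
Fact spec_mulC : commutative spec_mul.
Proof. by move=> s t; apply: spec_sec_eq => p Up; exact: mulrC. Qed.
Fact spec_mul1 : left_id spec1 spec_mul.
Proof. by move=> s; apply: spec_sec_eq => p Up; exact: mul1r. Qed.
Fact spec_mulD : left_distributive spec_mul spec_add.
Proof. by move=> r s t; apply: spec_sec_eq => p Up; exact: mulrDl. Qed.
HB.instance Definition _ := GRing.Zmodule_isComPzRing.Build (spec_sec U)
  spec_mulA spec_mulC spec_mul1 spec_mulD.

Lemma spec_secD s t p (Up : U p) : (s + t) p Up = s p Up + t p Up.
Proof. by []. Qed.
Lemma spec_secM s t p (Up : U p) : (s * t) p Up = s p Up * t p Up.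
Proof. by []. Qed.
Lemma spec_sec1 p (Up : U p) : (1 : spec_sec U) p Up = 1.
Proof. by []. Qed.
Lemma spec_sec0 p (Up : U p) : (0 : spec_sec U) p Up = 0.
Proof. by []. Qed.
End Ring.

Section Restriction.
Variables (U V : set X) (sVU : V `<=` U).

Fact spec_res_frac (s : spec_sec U) :
  locally_fraction (fun p (Vp : V p) => s p (sVU Vp)).
Proof.
move=> p Vp; have [W [oW Wp [a [f H]]]] := sfunP s (sVU Vp).
by exists W; split=> //; exists a, f => q Vq Wq; exact: H.
Qed.
Definition spec_res (s : spec_sec U) : spec_sec V := SpecSec (spec_res_frac s).

Fact spec_res_zmod : zmod_morphism spec_res.
Proof. by move=> s t; apply: spec_sec_eq. Qed.
Fact spec_res_monoid : monoid_morphism spec_res.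
Proof. by split=> [|s t]; apply: spec_sec_eq. Qed.
HB.instance Definition _ := GRing.isZmodMorphism.Build _ _ spec_res spec_res_zmod.
HB.instance Definition _ := GRing.isMonoidMorphism.Build _ _ spec_res spec_res_monoid.
End Restriction.

Definition spec_presheaf : presheaf X.
Proof.
refine (@Presheaf X (fun U => spec_sec U)
  (fun U V _ _ sVU => spec_res sVU) _ _).
- move=> U _ _ sUU s; apply: spec_sec_eq => p Up /=.
  by congr (sfun s _); exact: Prop_irrelevance.
- move=> U V W _ _ _ _ sVU sWV sWU s; apply: spec_sec_eq => p Wp /=.
  by congr (sfun s _); exact: Prop_irrelevance.
Defined.

Fact spec_separated : sheaf_separated spec_presheaf.
Proof.
move=> I U V oU oV sVU cU s t st; apply: spec_sec_eq => p Up.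
have [i _ Vp] := cU p Up.
have := congr1 (fun r : spec_sec (V i) => r p Vp) (st i) => /=.
by rewrite (Prop_irrelevance (sVU i p Vp) Up).
Qed.

Fact spec_gluing : sheaf_gluing spec_presheaf.
Proof.
move=> I U V oU oV sVU cU s compat.
have ov i j p (Vip : V i p) (Vjp : V j p) : sfun (s i) Vip = sfun (s j) Vjp.
  have oVij : open (V i `&` V j) by exact: openI.
  have := congr1 (fun r : spec_sec (V i `&` V j) => r p (conj Vip Vjp))
    (compat i j oVij) => /=.
  by rewrite (Prop_irrelevance (@subIsetl _ _ _ _ _) Vip)
    (Prop_irrelevance (@subIsetr _ _ _ _ _) Vjp).
have ex (p : X) (Up : U p) : {i | V i p}.
  by apply: cid; have [i _ ?] := cU p Up; exists i.
pose t p Up := sfun (s (sval (ex p Up))) (svalP (ex p Up)).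
have tE i p Up Vip : t p Up = sfun (s i) Vip by exact: ov.
have tP : locally_fraction t.
  move=> p Up; have [i Vip] := ex p Up.
  have [W [oW Wp [a [f H]]]] := sfunP (s i) Vip.
  exists (W `&` V i); split=> //; first exact: openI.
  exists a, f => q Uq [Wq Viq].
  by have [qf e] := H q Viq Wq; exists qf; rewrite (tE i _ _ Viq).
exists (SpecSec tP) => i; apply: spec_sec_eq => p Vip /=; exact: tE.
Qed.

Lemma spec_germ_unitP (p : X) (U : set X) (oU : open U) (Up : U p)
    (s : sec spec_presheaf U) :
  germ_unit p oU s <-> exists y : loc p, sfun (s : spec_sec U) Up * y = 1.
Proof.
split=> [[V [oV [sVU [Vp [t e]]]]]|[y e]].
  exists (sfun (t : spec_sec V) Vp).
  have -> : sfun (s : spec_sec U) Up = sfun (spec_res sVU s) Vp.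
    by rewrite /=; congr (sfun (s : spec_sec U) _); exact: Prop_irrelevance.
  exact: (congr1 (fun r : spec_sec V => sfun r Vp) e).
have [V [oV Vp [a [f H]]]] := sfunP (s : spec_sec U) Up.
have [pf sE] := H p Up Vp.
have pa : ~ pideal p a.
  have [b [g [pg yE]]] := fracP y; move: e; rewrite sE yE.
  rewrite (fracM _ _ _ _ (pideal_notM pf pg)) (frac1 (@pideal1 _ p)).
  move=> /frac_eq[u pu]; rewrite mulr1 mul1r => ue pa.
  have /pideal_prime[//|/pideal_prime[]//] : pideal p (u * (f * g)).
  have -> : u * (f * g) = (u * b) * a by apply: subr0_eq; rewrite -[RHS]oppr0 -ue; ring.
  exact: pidealM.
pose W := V `&` U `&` [set q : X | ~ pideal q a].
have oD : open [set q : X | ~ pideal q a].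
  by rewrite spectrum_open; apply/zariski_openP => q qa; exists a.
have oW : open W by apply: openI => //; exact: openI.
have sWU : W `<=` U by move=> q [[]].
have tP : locally_fraction (fun (q : X) (Wq : W q) => frac q f (let: conj _ h := Wq in h)).
  move=> q Wq; exists setT; split=> //; first exact: openT.
  exists f, a => r Wr _; have [_ ra] := Wr; exists ra.
  by congr (frac _ _ _); exact: Prop_irrelevance.
exists W, oW, sWU; split; first by split.
exists (SpecSec tP : sec spec_presheaf W); apply: spec_sec_eq => q Wq.
rewrite spec_secM /=.
have Vq : V q by case: Wq => -[].
have [qf ->] := H q (sWU q Wq) Vq.
rewrite (fracM _ _ _ _ (pideal_notM qf (let: conj _ h := Wq in h))).
by apply: frac_eq_mul; ring.
Qed.

Lemma spec_germ_fracP (p : X) (U : set X) (oU : open U) (Up : U p)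
    (s : sec spec_presheaf U) (a f : A) (pf : ~ pideal p f) :
  sfun (s : spec_sec U) Up = frac p a pf -> germ_unit p oU s <-> ~ pideal p a.
Proof.
move=> sE; rewrite (spec_germ_unitP oU Up) sE; split=> [[y]|pa].
  have [b [g [pg ->]]] := fracP y.
  rewrite (fracM _ _ _ _ (pideal_notM pf pg)) (frac1 (@pideal1 _ p)).
  move=> /frac_eq[u pu]; rewrite mulr1 mul1r => ue pa.
  have /pideal_prime[//|/pideal_prime[]//] : pideal p (u * (f * g)).
  have -> : u * (f * g) = (u * b) * a by apply: subr0_eq; rewrite -[RHS]oppr0 -ue; ring.
  exact: pidealM.
exists (frac p f pa); rewrite (fracM _ _ _ _ (pideal_notM pf pa)).
by rewrite (frac1 (@pideal1 _ p)); apply: frac_eq_mul; ring.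
Qed.

Fact spec_local : local_stalks spec_presheaf.
Proof.
move=> p U oU Up; split.
  move=> e; have := congr1 (fun r : spec_sec U => r p Up) e.
  rewrite spec_sec1 spec_sec0 (frac1 (@pideal1 _ p)) (frac0 (@pideal1 _ p)).
  move=> /frac_eq[u pu]; rewrite !mulr1 subr0 mulr1 => u0.
  by apply: pu; rewrite u0; exact: pideal0.
move=> s t.
have [a [f [pf sE]]] := fracP (sfun (s : spec_sec U) Up).
have [b [g [pg tE]]] := fracP (sfun (t : spec_sec U) Up).
have stE : sfun (s + t : spec_sec U) Up = frac p (a * g + b * f) (pideal_notM pf pg).
  by rewrite spec_secD sE tE; exact: fracD.
rewrite (spec_germ_fracP _ sE) (spec_germ_fracP _ tE) (spec_germ_fracP _ stE) => pab.
have [pa|] := pselect (pideal p a); last by left.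
right=> pb; apply: pab; apply: pidealD; last by rewrite mulrC; exact: pidealM.
by rewrite mulrC; exact: pidealM.
Qed.

Definition spec_lrs : lrs := LRS spec_separated spec_gluing spec_local.
End StructureSheaf.

Section SpecMorphism.
Variables (A B : comPzRingType) (phi : {rmorphism A -> B}).

Section Comap.
Variable q : prime_ideal B.
Let r (a : A) : Prop := pideal q (phi a).

Fact comapD x y : r x -> r y -> r (x + y).
Proof. by rewrite /r rmorphD; exact: pidealD. Qed.
Fact comapM x y : r y -> r (x * y).
Proof. by rewrite /r rmorphM; exact: pidealM. Qed.
Fact comap1 : ~ r 1.
Proof. by rewrite /r rmorph1; exact: pideal1. Qed.
Fact comap_prime x y : r (x * y) -> r x \/ r y.
Proof. by rewrite /r rmorphM; exact: pideal_prime. Qed.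
Fact comap0 : r 0.
Proof. by rewrite /r rmorph0; exact: pideal0. Qed.
Definition prime_comap : prime_ideal A :=
  PrimeIdeal comapD comapM comap1 comap_prime comap0.

Definition loc_map (x : loc prime_comap) : loc q :=
  let r : ratio prime_comap := repr (x : {eq_quot (@ratio_equiv A prime_comap)}%qT) in
  @frac B q (phi (num r)) (phi (den r)) (@den_notin _ _ r).

Lemma loc_mapE a f (pf : ~ pideal prime_comap f) (qf : ~ pideal q (phi f)) :
  loc_map (frac prime_comap a pf) = frac q (phi a) qf.
Proof.
have [b [g [pg]]] : exists b g (pg : ~ pideal prime_comap g),
    frac prime_comap b pg = frac prime_comap a pf /\
    loc_map (frac prime_comap a pf) = @frac B q (phi b) (phi g) pg.
  rewrite /loc_map; set x := (repr _).
  exists (num x), (den x), (@den_notin _ _ x); split=> //.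
  rewrite /frac -[RHS](@reprK _ {eq_quot (@ratio_equiv A prime_comap)}%qT).
  by congr (\pi_ _)%qT; rewrite -/x; case: x.
move=> [/frac_eq[u pu e] ->]; apply/frac_eq; exists (phi u) => //.
by rewrite -!rmorphM -rmorphB -rmorphM e rmorph0.
Qed.

Fact loc_map_zmod : zmod_morphism loc_map.
Proof.
move=> x y; have [a [f [pf ->]]] := fracP x; have [b [g [pg ->]]] := fracP y.
have qf : ~ pideal q (phi f) := pf; have qg : ~ pideal q (phi g) := pg.
have pfg := pideal_notM pf pg; have qfg : ~ pideal q (phi (f * g)) := pfg.
rewrite (fracN b) (fracD _ _ _ _ pfg) (loc_mapE _ _ qf) (loc_mapE _ _ qg).
rewrite (loc_mapE _ _ qfg) fracN (fracD _ _ _ _ (pideal_notM qf qg)).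
by apply: frac_eq_mul; rewrite !(rmorphM, rmorphD, rmorphN).
Qed.
Fact loc_map_monoid : monoid_morphism loc_map.
Proof.
split=> [|x y].
  have p1 := @pideal1 _ prime_comap; have q1 : ~ pideal q (phi 1) := p1.
  rewrite (frac1 p1) (loc_mapE _ _ q1) (frac1 (@pideal1 _ q)).
  by apply: frac_eq_mul; rewrite !rmorph1.
have [a [f [pf ->]]] := fracP x; have [b [g [pg ->]]] := fracP y.
have qf : ~ pideal q (phi f) := pf; have qg : ~ pideal q (phi g) := pg.
have pfg := pideal_notM pf pg; have qfg : ~ pideal q (phi (f * g)) := pfg.
rewrite (fracM _ _ _ _ pfg) (loc_mapE _ _ qf) (loc_mapE _ _ qg).
rewrite (loc_mapE _ _ qfg) (fracM _ _ _ _ (pideal_notM qf qg)).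
by apply: frac_eq_mul; rewrite !rmorphM.
Qed.
End Comap.

Definition spec_base (q : spectrum B) : spectrum A := prime_comap q.

Fact spec_base_cont : continuous spec_base.
Proof.
apply/continuousP => U; rewrite !spectrum_open => /zariski_openP oU.
apply/zariski_openP => q Uq; have [f pf sf] := oU _ Uq.
by exists (phi f) => // q' q'f; exact: sf.
Qed.

Section Pull.
Variable U : set (spectrum A).

Fact spec_pull_frac (s : spec_sec U) :
  @locally_fraction B (spec_base @^-1` U) (fun q Uq => loc_map (s (spec_base q) Uq)).
Proof.
move=> q Uq; have [V [oV Vq [a [f H]]]] := sfunP s Uq.
exists (spec_base @^-1` V); split=> //.
  by apply: preimage_open => //; exact: spec_base_cont.
exists (phi a), (phi f) => q' Uq' Vq'; have [pf ->] := H (spec_base q') Uq' Vq'.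
by exists pf; exact: loc_mapE.
Qed.
Definition spec_pull (s : spec_sec U) : spec_sec (spec_base @^-1` U) :=
  SpecSec (spec_pull_frac s).

Fact spec_pull_zmod : zmod_morphism spec_pull.
Proof. by move=> s t; apply: spec_sec_eq => q Uq; exact: loc_map_zmod. Qed.
Fact spec_pull_monoid : monoid_morphism spec_pull.
Proof.
by split=> [|s t]; apply: spec_sec_eq => q Uq; [exact: (loc_map_monoid _).1|
  exact: (loc_map_monoid _).2].
Qed.
HB.instance Definition _ := GRing.isZmodMorphism.Build _ _ spec_pull spec_pull_zmod.
HB.instance Definition _ := GRing.isMonoidMorphism.Build _ _ spec_pull spec_pull_monoid.
End Pull.

Definition spec_hom : lrs_hom (spec_lrs B) (spec_lrs A).
Proof.
refine (@LRSHom (spec_lrs B) (spec_lrs A) spec_base spec_base_cont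
  (fun U _ => @spec_pull U) _ _).
- move=> U V oU oV sVU oU' oV' sVU' s; apply: spec_sec_eq => q Vq /=.
  by congr (loc_map (sfun (s : spec_sec U) _)); exact: Prop_irrelevance.
- move=> q U oU oU' s Uq.
  have [a [f [pf sE]]] := fracP (sfun (s : spec_sec U) Uq).
  have pE : sfun (spec_pull (s : spec_sec U)) Uq = @frac B q (phi a) (phi f) pf.
    by rewrite /= sE; exact: loc_mapE.
  by rewrite (spec_germ_fracP oU sE) => /(spec_germ_fracP oU' pE).
Defined.
End SpecMorphism.

Lemma spec_hom_id (A : comPzRingType) (phi : {rmorphism A -> A}) :
  (forall a, phi a = a) -> spec_hom phi = idh (spec_lrs A).
Proof.
move=> phiE; have bE q : spec_base phi q = q.
  by apply: prime_ideal_eq => a /=; rewrite phiE.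
apply: lrs_hom_eq => //= U W oU oF oG oW sF sG s.
apply: spec_sec_eq => q Wq /=.
have [V [oV Vq [a [f H]]]] := sfunP (s : spec_sec U) (sG q Wq).
have [qf ->] := H q (sG q Wq) Vq.
have Vq' : V (spec_base phi q) by rewrite bE.
have [pf ->] := H (spec_base phi q) (sF q Wq) Vq'.
by rewrite loc_mapE; apply: frac_eq_mul; rewrite !phiE.
Qed.

Lemma spec_hom_comp (A B C : comPzRingType) (phi : {rmorphism A -> B})
    (psi : {rmorphism B -> C}) (chi : {rmorphism A -> C}) :
  (forall a, chi a = psi (phi a)) ->
  spec_hom chi = spec_hom phi \oh spec_hom psi.
Proof.
move=> chiE; have bE q : spec_base chi q = spec_base phi (spec_base psi q).
  by apply: prime_ideal_eq => a /=; rewrite chiE.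
apply: lrs_hom_eq => //= U W oU oF oG oW sF sG s.
apply: spec_sec_eq => q Wq /=.
have [V [oV Vq [a [f H]]]] := sfunP (s : spec_sec U) (sF q Wq).
have [qf ->] := H _ (sF q Wq) Vq.
have Vq' : V (spec_base phi (spec_base psi q)) by rewrite -bE.
have [pf ->] := H _ (sG q Wq) Vq'.
have h1 : ~ pideal q (chi f) := qf.
have h2 : ~ pideal (spec_base psi q) (phi f) := pf.
have h3 : ~ pideal q (psi (phi f)) := pf.
rewrite (loc_mapE _ _ h1) (loc_mapE _ _ h2) (loc_mapE _ _ h3).
by apply: frac_eq_mul; rewrite !chiE.
Qed.

(* a homeomorphism onto an open subset inducing an isomorphism between the
   structure sheaf of [X] and the restriction of that of [Y] to this subset *)
Definition open_immersion (X Y : lrs) (f : lrs_hom X Y) :=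
  [/\ injective f,
      forall U : set X, open U -> open (f @` U) &
      forall (U : set Y) (oU : open U), U `<=` range f -> bijective (pull f oU)].

Definition is_scheme (X : lrs) :=
  forall x : X, exists (A : comPzRingType) (f : lrs_hom (spec_lrs A) X),
    open_immersion f /\ range f x.

Record scheme := Scheme { scheme_lrs :> lrs; schemeP : is_scheme scheme_lrs }.

Fact spec_is_scheme (A : comPzRingType) : is_scheme (spec_lrs A).
Proof.
move=> x; exists A, (idh _); split; last by exists x.
split=> [//|U|U oU _]; first by rewrite image_id.
by exists id.
Qed.

Definition Spec (A : comPzRingType) : scheme := Scheme (@spec_is_scheme A).

Definition Spec_hom (A B : comPzRingType) (phi : {rmorphism A -> B}) :
  lrs_hom (Spec B) (Spec A) := spec_hom phi.

Lemma Spec_square (A B C D : comPzRingType)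
    (f : {rmorphism A -> B}) (g : {rmorphism B -> D})
    (h : {rmorphism A -> C}) (k : {rmorphism C -> D}) :
  (forall a, g (f a) = k (h a)) ->
  Spec_hom f \oh Spec_hom g = Spec_hom h \oh Spec_hom k.
Proof.
move=> e; rewrite /Spec_hom -(@spec_hom_comp _ _ _ f g (g \o f)) //.
exact: (@spec_hom_comp _ _ _ h k (g \o f)).
Qed.

Record fibre_product (S X Y : scheme) (p : lrs_hom X S) (q : lrs_hom Y S) :=
  FibreProduct {
  fp_scheme :> scheme;
  fp1 : lrs_hom fp_scheme X;
  fp2 : lrs_hom fp_scheme Y;
  fp_comm : p \oh fp1 = q \oh fp2;
  fp_lift : forall (T : scheme) (a : lrs_hom T X) (b : lrs_hom T Y),
    p \oh a = q \oh b -> lrs_hom T fp_scheme;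
  fp_lift1 : forall (T : scheme) (a : lrs_hom T X) (b : lrs_hom T Y)
    (e : p \oh a = q \oh b), fp1 \oh fp_lift e = a;
  fp_lift2 : forall (T : scheme) (a : lrs_hom T X) (b : lrs_hom T Y)
    (e : p \oh a = q \oh b), fp2 \oh fp_lift e = b;
  fp_unique : forall (T : scheme) (u v : lrs_hom T fp_scheme),
    fp1 \oh u = fp1 \oh v -> fp2 \oh u = fp2 \oh v -> u = v }.

Record model (R F : comPzRingType) (i : {rmorphism R -> F})
    (X : scheme) (pX : lrs_hom X (Spec F)) := Model {
  model_scheme :> scheme;
  model_map : lrs_hom model_scheme (Spec R);
  model_fibre : fibre_product model_map (Spec_hom i);
  model_iso : lrs_hom model_fibre X;
  model_inv : lrs_hom X model_fibre;
  model_isoK : model_inv \oh model_iso = idh model_fibre;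
  model_invK : model_iso \oh model_inv = idh X;
  model_iso_over : pX \oh model_iso = fp2 model_fibre }.

Definition model_generic (R F : comPzRingType) (i : {rmorphism R -> F})
    (X : scheme) (pX : lrs_hom X (Spec F)) (M : model i pX) : lrs_hom X M :=
  fp1 (model_fibre M) \oh model_inv M.

Record points (S T X : scheme) (pT : lrs_hom T S) (pX : lrs_hom X S) := Point {
  point_hom :> lrs_hom T X;
  point_over : pX \oh point_hom = pT }.

Section BaseChangePoints.
Variables (S X S' T T' : scheme) (pX : lrs_hom X S) (s : lrs_hom S' S).
Variables (pT : lrs_hom T S) (pT' : lrs_hom T' S') (g : lrs_hom T' T).
Hypothesis gE : pT \oh g = s \oh pT'.

Fact base_change_comm (P : points pT pX) : pX \oh (P \oh g) = s \oh pT'.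
Proof. by rewrite comphA point_over. Qed.

Definition base_change_point (Y : fibre_product pX s) (P : points pT pX) :
    points pT' (fp2 Y) :=
  Point (fp_lift2 Y (base_change_comm P)).
End BaseChangePoints.

Section GenericPoints.
Variables (R F : comPzRingType) (i : {rmorphism R -> F}).
Variables (X : scheme) (pX : lrs_hom X (Spec F)) (M : model i pX).
Variables (T T' : scheme) (pT : lrs_hom T (Spec R)) (pT' : lrs_hom T' (Spec F)).
Variable g : lrs_hom T' T.
Hypothesis gE : pT \oh g = Spec_hom i \oh pT'.

Fact generic_point_over (P : points pT (model_map M)) :
  pX \oh (model_iso M \oh base_change_point gE (model_fibre M) P) = pT'.
Proof. by rewrite comphA model_iso_over point_over. Qed.

Definition generic_point (P : points pT (model_map M)) : points pT' pX :=
  Point (generic_point_over P).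
End GenericPoints.

Definition is_set_action (G : groupType) (T : Type) (a : G -> T -> T) :=
  (forall x, a 1%g x = x) /\ (forall g h x, a (g * h)%g x = a g (a h x)).

Definition is_scheme_action (G : groupType) (X : scheme)
    (a : G -> lrs_hom X X) :=
  a 1%g = idh X /\ forall g h, a (g * h)%g = a g \oh a h.

Definition linear_over (S X Y : scheme) (alpha : lrs_hom S S)
    (pX : lrs_hom X S) (pY : lrs_hom Y S) (f : lrs_hom X Y) :=
  pY \oh f = alpha \oh pX.

Definition is_semilinear_action (G : groupType) (S X : scheme)
    (aS : G -> lrs_hom S S) (pX : lrs_hom X S) (aX : G -> lrs_hom X X) :=
  is_scheme_action aX /\ forall g, linear_over (aS g) pX pX (aX g).

Definition is_points_action (G : groupType) (S T X : scheme)
    (pT : lrs_hom T S) (pX : lrs_hom X S)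
    (aT : G -> lrs_hom T T) (aX : G -> lrs_hom X X)
    (act : G -> points pT pX -> points pT pX) :=
  (forall g P, act g P = aX g \oh P \oh aT g^-1%g :> lrs_hom T X) /\
  is_set_action act.

Definition base_change_compatible (S X S' : scheme) (pX : lrs_hom X S)
    (s : lrs_hom S' S) (Y : fibre_product pX s)
    (f : lrs_hom X X) (alpha : lrs_hom S' S') (b : lrs_hom Y Y) :=
  fp1 Y \oh b = f \oh fp1 Y /\ fp2 Y \oh b = alpha \oh fp2 Y.

Record ring_action (G : groupType) (R : comPzRingType) := RingAction {
  ring_act :> G -> {rmorphism R -> R};
  ring_act1 : forall x, ring_act 1%g x = x;
  ring_actM : forall g h x, ring_act (g * h)%g x = ring_act g (ring_act h x) }.

Definition ring_equivariant (G : groupType) (R R' : comPzRingType)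
    (a : ring_action G R) (a' : ring_action G R') (f : R -> R') :=
  forall g x, f (a g x) = a' g (f x).

Definition Spec_action (G : groupType) (R : comPzRingType)
    (a : ring_action G R) (g : G) : lrs_hom (Spec R) (Spec R) :=
  Spec_hom (a g^-1%g).

Lemma Spec_actionP (G : groupType) (R : comPzRingType) (a : ring_action G R) :
  is_scheme_action (Spec_action a).
Proof.
split=> [|g h]; rewrite /Spec_action /Spec_hom.
  by apply: spec_hom_id => x; rewrite invg1 ring_act1.
by apply: spec_hom_comp => x; rewrite invgM ring_actM.
Qed.

Definition separably_closed (L : fieldType) :=
  forall p : {poly L}, separable_poly p -> size p != 1 -> exists x, root p x.

Definition is_separable_closure (k L : fieldType) (i : {rmorphism k -> L}) :=
  (forall x : L, exists2 p : {poly k}, separable_poly p & root (map_poly i p) x) /\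
  separably_closed L.

Section GaloisGroup.
Variables (k L : fieldType) (i : {rmorphism k -> L}).

Record gal_group := Gal {
  gal_fun :> {rmorphism L -> L};
  gal_inv : {rmorphism L -> L};
  gal_funK : cancel gal_fun gal_inv;
  gal_invK : cancel gal_inv gal_fun;
  gal_fix : forall x, gal_fun (i x) = i x }.

Lemma gal_group_eq (s t : gal_group) : s =1 t -> s = t.
Proof.
case: s => s s' sK s'K si; case: t => t t' tK t'K ti /= st.
have {}st : s = t by exact: rmorphism_eq.
case: _ / st in tK t'K ti *.
have {}e : s' = t' by apply: rmorphism_eq => x; rewrite -[x in LHS]t'K sK.
case: _ / e in tK t'K *.
by rewrite (Prop_irrelevance sK tK) (Prop_irrelevance s'K t'K)
  (Prop_irrelevance si ti).
Qed.

HB.instance Definition _ := gen_eqMixin gal_group.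
HB.instance Definition _ := gen_choiceMixin gal_group.

Definition gal_one : gal_group :=
  @Gal idfun idfun (fun=> erefl) (fun=> erefl) (fun=> erefl).

Definition gal_mul (s t : gal_group) : gal_group.
Proof.
refine (@Gal (s \o t) (gal_inv t \o gal_inv s) _ _ _) => x /=.
- by rewrite !gal_funK.
- by rewrite !gal_invK.
- by rewrite !gal_fix.
Defined.

Definition gal_inverse (s : gal_group) : gal_group.
Proof.
refine (@Gal (gal_inv s) s _ _ _) => x /=.
- exact: gal_invK.
- exact: gal_funK.
- by rewrite -[in LHS](gal_fix s) gal_funK.
Defined.

Fact gal_mulA : associative gal_mul.
Proof. by move=> s t u; exact: gal_group_eq. Qed.
Fact gal_mul1 : left_id gal_one gal_mul.
Proof. by move=> s; exact: gal_group_eq. Qed.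
Fact gal_mulr1 : right_id gal_one gal_mul.
Proof. by move=> s; exact: gal_group_eq. Qed.
Fact gal_mulV : left_inverse gal_one gal_inverse gal_mul.
Proof. by move=> s; apply: gal_group_eq => x /=; exact: gal_funK. Qed.
Fact gal_mulrV : right_inverse gal_one gal_inverse gal_mul.
Proof. by move=> s; apply: gal_group_eq => x /=; exact: gal_invK. Qed.

HB.instance Definition _ := isGroup.Build gal_group
  gal_mulA gal_mul1 gal_mulr1 gal_mulV gal_mulrV.

Definition gal_action (G : groupType) (theta : {multiplicative G -> gal_group}) :
  ring_action G L.
Proof.
refine (@RingAction G L (fun g => gal_fun (theta g)) _ _) => [x|g h x].
- suff -> : theta 1%g = 1%g by [].
  by apply: (mulgI (theta 1%g)); rewrite -gmulfM !mulg1.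
- by rewrite gmulfM.
Defined.
End GaloisGroup.

Definition is_local (R : comUnitRingType) :=
  forall x y : R, x + y \is a GRing.unit ->
    x \is a GRing.unit \/ y \is a GRing.unit.

Definition is_local_hom (R S : comUnitRingType) (f : R -> S) :=
  forall x, f x \is a GRing.unit -> x \is a GRing.unit.

Definition is_residue_field (R : comUnitRingType) (k : fieldType)
    (pi : {rmorphism R -> k}) :=
  [/\ is_local R, forall y, exists x, pi x = y &
      forall x, pi x = 0 <-> x \isn't a GRing.unit].

Definition is_fraction_field (R : idomainType) (K : fieldType)
    (i : {rmorphism R -> K}) :=
  injective i /\ forall z, exists x y : R, y != 0 /\ z = i x / i y.

Definition is_integral_closure (R S L : nzRingType) (i : R -> L)
    (j : {rmorphism S -> L}) :=
  injective j /\ forall z : L, integralOver i z <-> exists x, j x = z.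

Definition is_ideal (R : comUnitRingType) (I : set R) :=
  [/\ I 0, forall x y, I x -> I y -> I (x + y) & forall x y, I y -> I (x * y)].

Definition is_dvr (R : idomainType) :=
  [/\ is_local R,
      forall I : set R, is_ideal I -> exists a, I = [set x | exists b, x = b * a] &
      exists2 x : R, x != 0 & x \isn't a GRing.unit].

(* A local ring such that simple roots of monic polynomials lift from its
   residue field [k]; elements of [k] are given by representatives in [R]. *)
Definition is_henselian (R : comUnitRingType) :=
  is_local R /\
  forall (p : {poly R}) (a0 : R), p \is monic ->
    p.[a0] \isn't a GRing.unit -> p^`().[a0] \is a GRing.unit ->
    exists2 a, root p a & a - a0 \isn't a GRing.unit.

(* [i : R -> Rsh] is the strict Henselisation of the local ring [R] with residue
   field [k], relative to the separable closure [ksep] of [k]: [Rsh] is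
   Henselian with residue field [ksep], and is universal among such rings. *)
Record is_strict_henselisation (R Rsh : comUnitRingType) (k ksep : fieldType)
    (pi : {rmorphism R -> k}) (c : {rmorphism k -> ksep})
    (i : {rmorphism R -> Rsh}) (pish : {rmorphism Rsh -> ksep}) : Prop := {
  sh_residue_base : is_residue_field pi;
  sh_closure : is_separable_closure c;
  sh_henselian : is_henselian Rsh;
  sh_residue : is_residue_field pish;
  sh_local : is_local_hom i;
  sh_compatible : forall x, pish (i x) = c (pi x);
  sh_universal : forall (B : comUnitRingType) (kB : fieldType)
    (piB : {rmorphism B -> kB}) (u : {rmorphism R -> B})
    (alpha : {rmorphism ksep -> kB}),
    is_henselian B -> is_residue_field piB -> separably_closed kB ->
    is_local_hom u -> (forall x, alpha (c (pi x)) = piB (u x)) ->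
    exists! v : {rmorphism Rsh -> B},
      [/\ is_local_hom v, forall x, v (i x) = u x &
          forall y, piB (v y) = alpha (pish y)] }.

(* Main.v *)
(* Uniqueness of the extensions [sM g] makes [g |-> sM g] multiplicative, and
   uniqueness in the universal property of the fibre product does the same for
   the action on the special fibre.  A point of [X] is determined by its
   structure map together with its image in the model, and a point of the
   special fibre by its two projections, so that equivariance of both maps on
   points reduces to the semilinearity of the structure maps.  Part (3) is then
   formal.  That [F -> Fsh] is equivariant is checked on [OF], whose fraction
   field is [F] because every element of [F] is algebraic over [K]. *)

Require Import Defs.
From HB Require Import structures.
From mathcomp Require Import all_boot all_order all_algebra all_field.
From mathcomp Require Import boolp classical_sets topology_structure.

Set Implicit Arguments.
Unset Strict Implicit.
Unset Printing Implicit Defensive.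

Import GRing.Theory.
Local Open Scope classical_set_scope.
Local Open Scope ring_scope.

(** * Fractions and integral closures *)

Section FractionField.
Variables (R : idomainType) (K : fieldType) (i : {rmorphism R -> K}).
Hypothesis hK : is_fraction_field i.

Lemma clear_denominators (p : {poly K}) :
  exists (q : {poly R}) (d : R), d != 0 /\ map_poly i q = i d *: p.
Proof.
have [inj_i surj_i] := hK.
elim/poly_ind: p => [|p c [q [d [d0 qE]]]].
  by exists 0, 1; rewrite oner_neq0 rmorph0 scaler0.
have [x [y [y0 cE]]] := surj_i c.
(* As [c = x / y] and [d] clears [p], the product [d * y] clears [p * 'X + c]. *)
exists ((y *: q) * 'X + (d * x)%:P), (d * y); rewrite mulf_neq0 //; split=> //.
have iy0 : i y != 0 by rewrite -(rmorph0 i) (inj_eq inj_i).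
rewrite rmorphD !rmorphM /= map_polyX map_polyZ !map_polyC /= qE.
rewrite scalerA -scalerAl scalerDr [i y * _]mulrC; congr (_ + _).
by rewrite cE -mul_polyC -!polyCM -mulrA [i y * _]mulrC divfK.
Qed.

Lemma fraction_field_hom_ext (L : fieldType) (f g : {rmorphism K -> L}) :
  (forall x, f (i x) = g (i x)) -> f =1 g.
Proof.
by move=> fg z; have [_ /(_ z)[x [y [_ ->]]]] := hK; rewrite !fmorph_div !fg.
Qed.
End FractionField.

(** With [n] the degree of [q] and [c] its leading coefficient, multiplying [q(z) = 0] by
    [c ^+ n.-1] gives a monic equation in [c * z]. *)
Lemma integral_lead_coef_mul (R L : idomainType) (f : {rmorphism R -> L})
    (q : {poly R}) (z : L) :
  injective f -> q != 0 -> root (map_poly f q) z ->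
  integralOver f (f (lead_coef q) * z).
Proof.
move=> inj_f q0 /eqP qz; set c := lead_coef q; set n := (size q).-1.
have sq : size q = n.+1 by rewrite prednK // lt0n size_poly_eq0.
(* A nonzero constant stays nonzero under the injective [f], so it has no root. Hence [n.-1] is a
   true predecessor. *)
have n0 : (0 < n)%N.
  case: n sq => // sq; have qC := size1_polyC (eq_leq sq).
  move: qz; rewrite qC map_polyC hornerC => qz.
  by move: q0; rewrite qC polyC_eq0 -(inj_eq inj_f) qz rmorph0 eqxx.
(* [r] is [c ^+ n.-1 * q] after the substitution [X := X / c]. *)
pose r : {poly R} := 'X^n + \poly_(k < n) (q`_k * c ^+ (n.-1 - k)).
exists r.
  apply/monicP.
  by rewrite lead_coefDl ?lead_coefXn // size_polyXn ltnS size_poly.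
apply/eqP; rewrite rmorphD /= map_polyXn hornerD hornerXn.
have -> : \poly_(k < n) (q`_k * c ^+ (n.-1 - k)) =
          \sum_(k < n) (q`_k * c ^+ (n.-1 - k)) *: 'X^k by rewrite poly_def.
rewrite rmorph_sum horner_sum /=.
have e : (\sum_(k < n) f q`_k * z ^+ k) + f c * z ^+ n = 0.
  apply: etrans qz; rewrite horner_coef size_map_inj_poly ?rmorph0 //.
  rewrite sq big_ord_recr /= coef_map.
  by congr (_ + _); apply: eq_bigr => k _; rewrite coef_map.
transitivity (f c ^+ n.-1 *
    ((\sum_(k < n) f q`_k * z ^+ k) + f c * z ^+ n)); last first.
  by rewrite e mulr0.
rewrite mulrDr addrC mulr_sumr; congr (_ + _); last first.
  by rewrite mulrA -exprSr prednK // exprMn.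
apply: eq_bigr => k _; rewrite map_polyZ map_polyXn hornerZ hornerXn.
rewrite rmorphM rmorphXn /= exprMn.
have -> : n.-1 = (n.-1 - k + k)%N by rewrite subnK // -ltnS prednK.
by rewrite addnK exprD [f q`_k * f c ^+ _]mulrC mulrACA.
Qed.

(** An element [z] of [F] is a root of some nonzero [q] over [O]. With [c] the leading coefficient
    of [q], both [c * z] and [c] are integral, so [z] is a quotient of elements of [OF]. *)
Lemma integral_closure_fraction_field (O : idomainType) (K : fieldType)
    (iK : {rmorphism O -> K}) (F : fieldExtType K) (OF : idomainType)
    (iF : {rmorphism OF -> F}) :
  is_fraction_field iK -> is_integral_closure (in_alg F \o iK) iF ->
  is_fraction_field iF.
Proof.
move=> hK [inj_iF intF]; split=> // z.
have /polyOver1P[p pE] := minPolyOver 1%AS z.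
have [q [d [d0 qE]]] := clear_denominators hK p.
pose f : {rmorphism O -> F} := in_alg F \o iK.
have inj_f : injective f by move=> x y /fmorph_inj/(proj1 hK).
have p0 : p != 0.
  by rewrite -(map_poly_eq0 (in_alg F)) -pE monic_neq0 ?monic_minPoly.
have id0 : iK d != 0 by rewrite -(rmorph0 iK) (inj_eq (proj1 hK)).
have q0 : q != 0.
  apply: contraNneq p0 => q0; move: qE; rewrite q0 rmorph0 => /esym/eqP.
  by rewrite scaler_eq0 (negPf id0).
have qz : root (map_poly f q) z.
  by rewrite map_poly_comp qE map_polyZ rootZ ?fmorph_eq0 // -pE root_minPoly.
have /intF[x xE] := integral_lead_coef_mul inj_f q0 qz.
have /intF[y yE] : integralOver f (f (lead_coef q)) by exact: integral_id.
have c0 : f (lead_coef q) != 0.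
  by rewrite -(rmorph0 f) (inj_eq inj_f) lead_coef_eq0.
exists x, y; split; last by rewrite xE yE mulrC mulKf.
by apply: contraNneq c0 => y0; rewrite -yE y0 rmorph0.
Qed.

(** * Morphisms into a model and its generic fibre *)

Lemma point_eq (S T X : scheme) (pT : lrs_hom T S) (pX : lrs_hom X S)
    (P Q : points pT pX) :
  point_hom P = point_hom Q -> P = Q.
Proof.
case: P Q => P hP [Q hQ] /= PQ; case: _ / PQ in hQ *.
by rewrite (Prop_irrelevance hP hQ).
Qed.

(** Through [model_inv M], the maps [model_generic M] and [pX] become the two projections of a fibre
    product, which are jointly monic. *)
Lemma model_generic_inj (R F : comPzRingType) (i : {rmorphism R -> F})
    (X : scheme) (pX : lrs_hom X (Spec F)) (M : model i pX)
    (T : scheme) (u v : lrs_hom T X) :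
  pX \oh u = pX \oh v -> model_generic M \oh u = model_generic M \oh v -> u = v.
Proof.
have fp2_inv (w : lrs_hom T X) :
    fp2 (model_fibre M) \oh (model_inv M \oh w) = pX \oh w.
  rewrite -model_iso_over comphA -[_ \oh model_inv M]comphA.
  by rewrite model_invK comph1.
rewrite -!fp2_inv /model_generic -!comphA => e2 e1.
by rewrite -[u]comp1h -[v]comp1h -(model_invK M) -!comphA (fp_unique e1 e2).
Qed.

Lemma model_generic_point (R F : comPzRingType) (i : {rmorphism R -> F})
    (X : scheme) (pX : lrs_hom X (Spec F)) (M : model i pX)
    (T T' : scheme) (pT : lrs_hom T (Spec R)) (pT' : lrs_hom T' (Spec F))
    (g : lrs_hom T' T) (gE : pT \oh g = Spec_hom i \oh pT')
    (P : points pT (model_map M)) :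
  model_generic M \oh generic_point gE P = P \oh g.
Proof.
rewrite /= /model_generic -comphA [model_inv M \oh _]comphA model_isoK comp1h.
exact: fp_lift1.
Qed.

(** * Equivariance of ring maps *)

Lemma Spec_action_semilinear (G : groupType) (R R' : comPzRingType)
    (a : ring_action G R) (a' : ring_action G R') (f : {rmorphism R -> R'}) :
  ring_equivariant a a' f ->
  is_semilinear_action (Spec_action a) (Spec_hom f) (Spec_action a').
Proof.
move=> af; split=> [|g]; first exact: Spec_actionP.
by apply: Spec_square => x; rewrite af.
Qed.

Lemma ring_equivariant_surj (G : groupType) (R R' R'' : comPzRingType)
    (a : ring_action G R) (a' : ring_action G R') (a'' : ring_action G R'')
    (p : R -> R') (f : R' -> R'') :
  (forall y, exists x, p x = y) -> ring_equivariant a a' p ->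
  ring_equivariant a a'' (f \o p) -> ring_equivariant a' a'' f.
Proof.
by move=> psurj ap afp g y; have [x <-] := psurj y; rewrite -ap [LHS]afp.
Qed.

Lemma ring_equivariant_inj (G : groupType) (R R' R'' : comPzRingType)
    (a : ring_action G R) (a' : ring_action G R') (a'' : ring_action G R'')
    (f : R -> R') (j : R' -> R'') :
  injective j -> ring_equivariant a' a'' j ->
  ring_equivariant a a'' (j \o f) -> ring_equivariant a a' f.
Proof. by move=> jinj aj ajf g x; apply: jinj; rewrite aj [LHS]ajf. Qed.

(** * Semilinear actions on points, base changes and models *)

Section SemilinearActions.
Variable G : groupType.

Lemma points_action_exists (S T X : scheme) (aS : G -> lrs_hom S S)
    (pT : lrs_hom T S) (pX : lrs_hom X S)
    (aT : G -> lrs_hom T T) (aX : G -> lrs_hom X X) :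
  is_scheme_action aS -> is_semilinear_action aS pT aT ->
  is_semilinear_action aS pX aX ->
  exists act : G -> points pT pX -> points pT pX,
    is_points_action aT aX act.
Proof.
move=> [aS1 aSM] [[aT1 aTM] aTl] [[aX1 aXM] aXl].
(* The twist by [aS g] coming from [aX g] cancels the twist by [aS g^-1] coming from [aT g^-1]. *)
have over g (P : points pT pX) : pX \oh (aX g \oh P \oh aT g^-1%g) = pT.
  rewrite !comphA aXl -[_ \oh pX \oh P]comphA point_over -comphA aTl comphA.
  by rewrite -aSM mulgV aS1 comp1h.
exists (fun g P => Point (over g P)); split=> //; split=> [P|g h P].
  by apply: point_eq; rewrite /= invg1 aX1 aT1 comp1h comph1.
by apply: point_eq; rewrite /= invgM aXM aTM !comphA.
Qed.

Lemma base_change_compatible_unique (S X S' : scheme) (pX : lrs_hom X S)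
    (s : lrs_hom S' S) (Y : fibre_product pX s)
    (f : lrs_hom X X) (alpha : lrs_hom S' S') (b b' : lrs_hom Y Y) :
  base_change_compatible f alpha b -> base_change_compatible f alpha b' ->
  b = b'.
Proof. by move=> [e1 e2] [e1' e2']; apply: fp_unique; rewrite ?e1 ?e2. Qed.

Lemma base_change_action (S X S' : scheme) (aS : G -> lrs_hom S S)
    (pX : lrs_hom X S) (s : lrs_hom S' S) (aX : G -> lrs_hom X X)
    (aS' : G -> lrs_hom S' S') (Y : fibre_product pX s) :
  is_semilinear_action aS pX aX -> is_semilinear_action aS s aS' ->
  exists aY : G -> lrs_hom Y Y,
    (forall g, unique (base_change_compatible (aX g) (aS' g)) (aY g)) /\
    is_semilinear_action aS' (fp2 Y) aY.
Proof.
move=> [[aX1 aXM] aXl] [[aS1 aSM] aSl].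
have comm g : pX \oh (aX g \oh fp1 Y) = s \oh (aS' g \oh fp2 Y).
  by rewrite !comphA aXl aSl -!comphA fp_comm.
pose aY g := fp_lift Y (comm g).
have aYP g : base_change_compatible (aX g) (aS' g) (aY g).
  by split; [exact: fp_lift1|exact: fp_lift2].
exists aY; split=> [g|].
  by split=> // b; exact: base_change_compatible_unique.
split=> [|g]; last exact: (aYP g).2.
split=> [|g h]; apply: base_change_compatible_unique (aYP _) _.
  by rewrite aX1 aS1; split; rewrite comp1h comph1.
have [[g1 g2] [h1 h2]] := (aYP g, aYP h).
by split; rewrite comphA ?g1 ?g2 -comphA ?h1 ?h2 comphA ?aXM ?aSM.
Qed.

(** Taking [T] itself as the base, [linear_over] expresses that [g] commutes with the actions on
    [T'] and [T]. This moves the inverse automorphism past [g]. *)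
Lemma base_change_point_equivariant (S X S' T T' : scheme)
    (pX : lrs_hom X S) (s : lrs_hom S' S) (pT : lrs_hom T S)
    (pT' : lrs_hom T' S') (g : lrs_hom T' T) (gE : pT \oh g = s \oh pT')
    (Y : fibre_product pX s)
    (aX : G -> lrs_hom X X) (aS' : G -> lrs_hom S' S')
    (aT : G -> lrs_hom T T) (aT' : G -> lrs_hom T' T') (aY : G -> lrs_hom Y Y)
    (act : G -> points pT pX -> points pT pX)
    (act' : G -> points pT' (fp2 Y) -> points pT' (fp2 Y)) :
  (forall sigma, linear_over (aT sigma) g g (aT' sigma)) ->
  (forall sigma, base_change_compatible (aX sigma) (aS' sigma) (aY sigma)) ->
  is_points_action aT aX act -> is_points_action aT' aY act' ->
  forall sigma P, base_change_point gE Y (act sigma P) =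
                  act' sigma (base_change_point gE Y P).
Proof.
move=> gl aYP [actE _] [actE' _] sigma P; apply: point_eq.
(* The second projections agree, both being the structure map [pT']. *)
apply: fp_unique; last by rewrite !point_over.
rewrite [LHS]fp_lift1 actE actE' !comphA (aYP sigma).1.
rewrite -[X in _ = X \oh _]comphA [fp1 Y \oh _]fp_lift1 -!comphA.
by rewrite gl.
Qed.

Lemma model_action (R F : comPzRingType) (i : {rmorphism R -> F})
    (X : scheme) (pX : lrs_hom X (Spec F)) (M : model i pX)
    (aR : G -> lrs_hom (Spec R) (Spec R)) (sX : G -> lrs_hom X X)
    (sM : G -> lrs_hom M M) :
  is_scheme_action aR -> is_scheme_action sX ->
  (forall g, unique (fun m : lrs_hom M M =>
     linear_over (aR g) (model_map M) (model_map M) m /\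
     m \oh model_generic M = model_generic M \oh sX g) (sM g)) ->
  is_semilinear_action aR (model_map M) sM.
Proof.
move=> [aR1 aRM] [sX1 sXM] hM; split=> [|g]; last by have [[]] := hM g.
split=> [|g h].
  (* The identity extends [sX 1], and below [sM g \oh sM h] extends [sX (g * h)]. *)
  have [_] := hM 1%g; apply; split; last by rewrite sX1 comp1h comph1.
  by rewrite /linear_over aR1 comp1h comph1.
have [[[lg eg] _] [[lh eh] _]] := (hM g, hM h).
have [_] := hM (g * h)%g; apply; split.
  by rewrite /linear_over comphA lg -comphA lh comphA aRM.
by rewrite -comphA eh comphA eg -comphA sXM.
Qed.

Lemma generic_point_equivariant (R F : comPzRingType) (i : {rmorphism R -> F})
    (X : scheme) (pX : lrs_hom X (Spec F)) (M : model i pX)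
    (T T' : scheme) (pT : lrs_hom T (Spec R)) (pT' : lrs_hom T' (Spec F))
    (g : lrs_hom T' T) (gE : pT \oh g = Spec_hom i \oh pT')
    (sX : G -> lrs_hom X X) (sM : G -> lrs_hom M M)
    (aT : G -> lrs_hom T T) (aT' : G -> lrs_hom T' T')
    (act : G -> points pT (model_map M) -> points pT (model_map M))
    (act' : G -> points pT' pX -> points pT' pX) :
  (forall sigma, linear_over (aT sigma) g g (aT' sigma)) ->
  (forall sigma, sM sigma \oh model_generic M = model_generic M \oh sX sigma) ->
  is_points_action aT sM act -> is_points_action aT' sX act' ->
  forall sigma P, generic_point gE (act sigma P) =
                  act' sigma (generic_point gE P).
Proof.
move=> gl sMX [actE _] [actE' _] sigma P; apply: point_eq.
apply: (model_generic_inj (M := M)); first by rewrite !point_over.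
rewrite model_generic_point actE actE'.
(* Only the image of the generic point in the model matters, so the point is abstracted to [Q] with
   the equation [QE]. *)
move: (generic_point gE P) (model_generic_point gE P) => Q QE.
by rewrite !comphA -sMX -[sM sigma \oh _ \oh Q]comphA QE -!comphA gl.
Qed.
End SemilinearActions.

Theorem theorem3p1
  (* the Henselian DVR O and its fraction field K *)
  (O : idomainType) (hO_dvr : is_dvr O) (hO_hens : is_henselian O)
  (K : fieldType) (iK : {rmorphism O -> K}) (hK : is_fraction_field iK)
  (* the finite Galois extension F/K, with O_F and k_F *)
  (F : splittingFieldType K) (hF : galois 1%AS {:F}%AS)
  (OF : idomainType) (iF : {rmorphism OF -> F})
  (hOF : is_integral_closure (in_alg F \o iK) iF)
  (kF : fieldType) (piF : {rmorphism OF -> kF}) (hkF : is_residue_field piF)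
  (* the separable closure of K, containing F *)
  (Kbar : fieldType) (iKbar : {rmorphism K -> Kbar})
  (hKbar : is_separable_closure iKbar)
  (jF : {rmorphism F -> Kbar}) (hjF : forall x : K, jF x%:A = iKbar x)
  (* the strict Henselisation of O_F, realised inside Kbar, with its residue
     field kbar, a separable closure of k_F, and its fraction field Fsh *)
  (Osh : idomainType) (ish : {rmorphism OF -> Osh})
  (kbar : fieldType) (ck : {rmorphism kF -> kbar})
  (pish : {rmorphism Osh -> kbar})
  (hsh : is_strict_henselisation piF ck ish pish)
  (jsh : {rmorphism Osh -> Kbar}) (hjsh_inj : injective jsh)
  (hjsh : forall x : OF, jsh (ish x) = jF (iF x))
  (Fsh : fieldType) (iFsh : {rmorphism Osh -> Fsh})
  (hFsh : is_fraction_field iFsh)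
  (cF : {rmorphism F -> Fsh}) (hcF : forall x : OF, iFsh (ish x) = cF (iF x))
  (* the group G and its induced actions on these rings *)
  (G : groupType) (theta : {multiplicative G -> gal_group iKbar})
  (aF : ring_action G F) (haF : ring_equivariant aF (gal_action theta) jF)
  (aOF : ring_action G OF) (haOF : ring_equivariant aOF aF iF)
  (akF : ring_action G kF) (hakF : ring_equivariant aOF akF piF)
  (aOsh : ring_action G Osh)
  (haOsh : ring_equivariant aOsh (gal_action theta) jsh)
  (akbar : ring_action G kbar) (hakbar : ring_equivariant aOsh akbar pish)
  (aFsh : ring_action G Fsh) (haFsh : ring_equivariant aOsh aFsh iFsh)
  (* the F-scheme X with its semilinear action, and its model M *)
  (X : scheme) (pX : lrs_hom X (Spec F)) (sX : G -> lrs_hom X X)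
  (hX : is_semilinear_action (Spec_action aF) pX sX)
  (M : model iF pX)
  (sM : G -> lrs_hom M M)
  (hM : forall g : G, unique
     (fun m : lrs_hom M M =>
        linear_over (Spec_action aOF g) (model_map M) (model_map M) m /\
        m \oh model_generic M = model_generic M \oh sX g)
     (sM g))
  (* the special fibre *)
  (Mk : fibre_product (model_map M) (Spec_hom piF)) :
  (* the natural maps M(Osh) -> X(Fsh) and M(Osh) -> Mk(kbar) *)
  let gen : points (Spec_hom ish) (model_map M) -> points (Spec_hom cF) pX :=
    generic_point (Spec_square hcF) in
  let red : points (Spec_hom ish) (model_map M) ->
            points (Spec_hom ck) (fp2 Mk) :=
    base_change_point (Spec_square (sh_compatible hsh)) Mk in
  (* (1) *)
  is_semilinear_action (Spec_action aOF) (model_map M) sM /\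
  exists sMk : G -> lrs_hom Mk Mk,
    (forall g, unique
       (base_change_compatible (sM g) (Spec_action akF g)) (sMk g)) /\
    is_semilinear_action (Spec_action akF) (fp2 Mk) sMk /\
  exists actO actF actk,
    is_points_action (Spec_action aOsh) sM actO /\
    is_points_action (Spec_action aFsh) sX actF /\
    is_points_action (Spec_action akbar) sMk actk /\
  (* (2) *)
    (forall g P, gen (actO g P) = actF g (gen P)) /\
    (forall g P, red (actO g P) = actk g (red P)) /\
  (* (3) *)
    (forall gen_inv, cancel gen gen_inv -> cancel gen_inv gen ->
       forall (g : G) (Pbar : points (Spec_hom ck) (fp2 Mk)),
         range red Pbar ->
         range red (actk g Pbar) /\
         forall P, red P = Pbar ->
           red (gen_inv (actF g (gen P))) = actk g Pbar).
Proof.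
move=> gen red.
have hF' := integral_closure_fraction_field hK hOF.
(* Both actions are restrictions of the Galois action on [Kbar], into which [Osh] embeds. *)
have eish : ring_equivariant aOF aOsh ish.
  apply: ring_equivariant_inj hjsh_inj haOsh _ => g x /=.
  by rewrite !hjsh haOF haF.
(* Elements of [kF] lift to [OF], where the claim follows from the equivariance of [ish] and
   [pish]. *)
have eck : ring_equivariant akF akbar ck.
  have [_ piF_surj _] := hkF.
  apply: ring_equivariant_surj piF_surj hakF _ => g x /=.
  by rewrite -!(sh_compatible hsh) eish hakbar.
have ecF : ring_equivariant aF aFsh cF.
  move=> g; apply: (fraction_field_hom_ext hF' (f := cF \o aF g)
    (g := aFsh g \o cF)) => x /=.
  by rewrite -haOF -!hcF eish haFsh.
have sMP := model_action (Spec_actionP aOF) hX.1 hM; split=> //.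
have [sMk [sMkP sMkA]] :=
  base_change_action Mk sMP (Spec_action_semilinear hakF).
exists sMk; do 2!split=> //.
have [actO actOP] := points_action_exists (Spec_actionP aOF)
  (Spec_action_semilinear eish) sMP.
have [actF actFP] := points_action_exists (Spec_actionP aF)
  (Spec_action_semilinear ecF) hX.
have [actk actkP] := points_action_exists (Spec_actionP akF)
  (Spec_action_semilinear eck) sMkA.
have genE g P : gen (actO g P) = actF g (gen P).
  apply: generic_point_equivariant actOP actFP _ _.
    (* Semilinearity here is the equivariance of [Spec Fsh -> Spec Osh]. *)
    exact: (Spec_action_semilinear haFsh).2.
  by move=> sigma; have [[]] := hM sigma.
have redE g P : red (actO g P) = actk g (red P).
  apply: base_change_point_equivariant actOP actkP _ _.
    exact: (Spec_action_semilinear hakbar).2.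
  by move=> sigma; exact: (sMkP sigma).1.
exists actO, actF, actk; do 5!split=> //.
(* Conjugating [actF g] by the bijection [gen] gives [actO g], which commutes with [red]; hence any
   lift [Q] gives the same result. *)
move=> gen_inv genK _ g _ [P _ <-]; split=> [|Q <-].
  by rewrite -redE; exists (actO g P).
by rewrite -genE genK redE.
Qed.
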